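(* For any set $\Gamma\cup\{\phi\}$ of formulas in the language of $\mathbf{PT}^+$: if $\Gamma\vdash\phi$ in the natural deduction system of $\mathbf{PT}^+$, then $\Gamma\models\phi$.
   Context: Formulas of $\mathbf{PT}^+$: $\phi::=p_i\mid\neg p_i\mid\bot\mid\mathrm{NE}\mid\phi\wedge\phi\mid\phi\otimes\phi\mid\phi\vee\phi$ ($i\in\mathbb N$). A valuation is $s:\mathbb N\to\{0,1\}$ (or on a subset $N$), a team a set of valuations. Semantics: $X\models p_i$ iff $s(i)=1$ for all $s\in X$; $X\models\neg p_i$ iff $s(i)=0$ for all $s\in X$; $X\models\bot$ iff $X=\emptyset$; $X\models\mathrm{NE}$ iff $X\ne\emptyset$; $X\models\phi\wedge\psi$ iff both; $X\models\phi\otimes\psi$ iff $X=Y\cup Z$ for some $Y,Z\subseteq X$ with $Y\models\phi$, $Z\models\psi$; $X\models\phi\vee\psi$ iff $X\models\phi$ or $X\models\psi$. $\Gamma\models\phi$: every team satisfying all of $\Gamma$ satisfies $\phi$. Classical formulas are those built from $p_i,\neg p_i,\bot$ by $\wedge,\otimes$. $p_i^1=p_i$, $p_i^0=\neg p_i$; empty $\otimes$-disjunction is $\bot$, empty $\vee$-disjunction is $\bot\wedge\mathrm{NE}$. For a team $X$ on finite $\{i_1,\dots,i_n\}$, $\Theta^*_X=\bigotimes_{s\in X}(p_{i_1}^{s(i_1)}\wedge\dots\wedge p_{i_n}^{s(i_n)}\wedge\mathrm{NE})$. Natural deduction system of $\mathbf{PT}^+$ ($\Gamma\vdash\phi$ iff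 there is a derivation of $\phi$ whose undischarged assumptions are in $\Gamma$; $\phi,\psi,\chi,\phi_i$ range over all formulas, but axioms are the specific formulas shown, and there is no substitution rule). Axioms: $p_i\otimes\neg p_i$ (each $i$); $\bot\vee\mathrm{NE}$. Rules: $\wedge$-introduction and $\wedge$-elimination (standard); $\vee$-introduction (from $\phi$ infer $\phi\vee\psi$ and $\psi\vee\phi$) and $\vee$-elimination (from $\phi\vee\psi$, a derivation of $\chi$ from $\phi$ and one from $\psi$, infer $\chi$, discharging $\phi,\psi$); from $\phi$ infer $\phi\otimes\psi$ provided $\psi$ does not contain $\mathrm{NE}$; from $\phi$ infer $\phi\otimes\phi$; from $\phi\otimes\psi$, a derivation of $\alpha$ from $\phi$ and a derivation of $\alpha$ from $\psi$, infer $\alpha$ (discharging $\phi,\psi$), provided $\alpha$ is classical and the other undischarged assumptions of the two subderivations are classical; from $\phi\otimes\psi$ and a derivation of $\chi$ from $\psi$ (discharged) infer $\phi\otimes\chi$, provided the other undischarged assumptions of that subderivation are classical; from $\phi\otimes\psi$ infer $\psi\otimes\phi$; from $\phi\otimes(\psi\otimes\chi)$ infer $(\phi\otimes\psi)\otimes\chi$; from $p_i\wedge\neg p_i$ infer $\bot$; from $\phi\otimes\bot$ infer $\phi$; from $\bot\wedge\mathrm{NE}$ infer any $\phi$; from $\phi\otimes(\bot\wedge\mathrm{NE})$ infer $\bot\wedge\mathrm{NE}$; from $\Theta^*_X\wedge\Theta^*_Y$ infer $\bot\wedge\mathrm{NE}$ whenever $X,Y$ are distinct teams on the same finite set $\{i_1,\dots,i_n\}$;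 from $\phi\otimes(\psi\vee\chi)$ infer $(\phi\otimes\psi)\vee(\phi\otimes\chi)$; from $\mathrm{NE}\wedge\bigotimes_{i\in I}\phi_i$ ($I$ finite) infer $\bigvee_{\emptyset\ne J\subseteq I}\bigotimes_{i\in J}(\mathrm{NE}\wedge\phi_i)$. *)

(* Defs.v *)
From mathcomp Require Import all_boot finmap classical_sets.

Set Implicit Arguments.
Unset Strict Implicit.
Unset Printing Implicit Defensive.

Local Open Scope classical_set_scope.

Inductive form : Type :=
  | Var of nat
  | NVar of nat
  | Bot
  | NE
  | And of form & form
  | Tensor of form & form
  | Or of form & form.

Definition valuation := nat -> bool.
Definition team := set valuation.

Fixpoint sat (X : team) (phi : form) : Prop :=
  match phi with
  | Var i => forall s, X s -> s i = true
  | NVar i => forall s, X s -> s i = false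
  | Bot => X = set0
  | NE => X <> set0
  | And phi1 phi2 => sat X phi1 /\ sat X phi2
  | Tensor phi1 phi2 => exists Y Z : team,
      [/\ Y `<=` X, Z `<=` X, X = Y `|` Z, sat Y phi1 & sat Z phi2]
  | Or phi1 phi2 => sat X phi1 \/ sat X phi2
  end.

Definition entails (Gamma : set form) (phi : form) : Prop :=
  forall X : team, (forall psi, Gamma psi -> sat X psi) -> sat X phi.

Fixpoint classical (phi : form) : bool :=
  match phi with
  | Var _ | NVar _ | Bot => true
  | NE | Or _ _ => false
  | And phi1 phi2 | Tensor phi1 phi2 => classical phi1 && classical phi2
  end.

Fixpoint contains_NE (phi : form) : bool :=
  match phi with
  | Var _ | NVar _ | Bot => false
  | NE => true
  | And phi1 phi2 | Tensor phi1 phi2 | Or phi1 phi2 =>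
      contains_NE phi1 || contains_NE phi2
  end.

(* Iterated connectives associate to the right; the default value occurs only
   for the empty list, so the iteration over [:: a] is a itself.  Families indexed
   by a finite set are listed in the order of [enum]; the formulas obtained from
   other orders or bracketings are interderivable. *)
Fixpoint iterate (op : form -> form -> form) (dflt : form) (l : seq form) :=
  match l with
  | [::] => dflt
  | [:: a] => a
  | a :: l' => op a (iterate op dflt l')
  end.

Definition big_tensor : seq form -> form := iterate Tensor Bot.
Definition big_or : seq form -> form := iterate Or (And Bot NE).

Definition lit (i : nat) (b : bool) : form := if b then Var i else NVar i.

(* A valuation on the finite set N is a finite function N -> bool, and a team on
   N is a finite set of those. *)
Definition Theta (N : {fset nat}) (X : {set {ffun N -> bool}}) : form :=
  big_tensor [seq foldr And NE [seq lit (val i) (s i) | i <- enum {: N}]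
              | s : {ffun N -> bool} <- enum X].

(* [deriv A phi]: there is a derivation of phi whose set of undischarged
   assumptions is A.  A discharge removes every occurrence of the discharged
   formula; discharging only some of them would yield no further consequence,
   because the side conditions only become easier with fewer assumptions. *)
Inductive deriv : set form -> form -> Prop :=
  | D_assume phi : deriv [set phi] phi
  | D_ax_tensor i : deriv set0 (Tensor (Var i) (NVar i))
  | D_ax_NE : deriv set0 (Or Bot NE)
  | D_andI A B phi psi :
      deriv A phi -> deriv B psi -> deriv (A `|` B) (And phi psi)
  | D_andEl A phi psi : deriv A (And phi psi) -> deriv A phi
  | D_andEr A phi psi : deriv A (And phi psi) -> deriv A psi
  | D_orIl A phi psi : deriv A phi -> deriv A (Or phi psi)
  | D_orIr A phi psi : deriv A phi -> deriv A (Or psi phi)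
  | D_orE A B C phi psi chi :
      deriv A (Or phi psi) -> deriv B chi -> deriv C chi ->
      deriv (A `|` (B `\ phi) `|` (C `\ psi)) chi
  | D_tensorI A phi psi :
      ~~ contains_NE psi -> deriv A phi -> deriv A (Tensor phi psi)
  | D_tensor_dup A phi : deriv A phi -> deriv A (Tensor phi phi)
  | D_tensorE A B C phi psi alpha :
      classical alpha ->
      (forall theta, (B `\ phi) theta -> classical theta) ->
      (forall theta, (C `\ psi) theta -> classical theta) ->
      deriv A (Tensor phi psi) -> deriv B alpha -> deriv C alpha ->
      deriv (A `|` (B `\ phi) `|` (C `\ psi)) alpha
  | D_tensor_sub A B phi psi chi :
      (forall theta, (B `\ psi) theta -> classical theta) ->
      deriv A (Tensor phi psi) -> deriv B chi ->
      deriv (A `|` (B `\ psi)) (Tensor phi chi)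
  | D_tensorC A phi psi : deriv A (Tensor phi psi) -> deriv A (Tensor psi phi)
  | D_tensorA A phi psi chi :
      deriv A (Tensor phi (Tensor psi chi)) ->
      deriv A (Tensor (Tensor phi psi) chi)
  | D_contra A i : deriv A (And (Var i) (NVar i)) -> deriv A Bot
  | D_tensor_Bot A phi : deriv A (Tensor phi Bot) -> deriv A phi
  | D_exfalso A phi : deriv A (And Bot NE) -> deriv A phi
  | D_tensor_exfalso A phi :
      deriv A (Tensor phi (And Bot NE)) -> deriv A (And Bot NE)
  | D_Theta A (N : {fset nat}) (X Y : {set {ffun N -> bool}}) :
      X <> Y -> deriv A (And (Theta X) (Theta Y)) -> deriv A (And Bot NE)
  | D_tensor_or A phi psi chi :
      deriv A (Tensor phi (Or psi chi)) ->
      deriv A (Or (Tensor phi psi) (Tensor phi chi))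
  | D_NE_tensor A (I : finType) (phi : I -> form) :
      deriv A (And NE (big_tensor [seq phi i | i <- enum I])) ->
      deriv A (big_or [seq big_tensor [seq And NE (phi i) | i <- enum J]
                      | J : {set I} <- enum [pred J : {set I} | J != finset.set0]]).

Definition provable (Gamma : set form) (phi : form) : Prop :=
  exists2 A : set form, A `<=` Gamma & deriv A phi.

(* Main.v *)
(** Soundness by induction on derivations.  Two facts carry the rules with side
    conditions: classical formulas are inherited by subteams
    and by unions, and NE-free formulas hold in the empty team.  A team satisfies
    an iterated tensor exactly when it is covered by a family of teams satisfying
    the components; hence a team satisfying [Theta X] has exactly [X] as its set
    of restrictions, and in the NE-distribution rule one takes for [J] the set of
    indices of the nonempty pieces. *)

Require Import Defs.
From mathcomp Require Import all_boot classical_sets.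
From mathcomp Require Import boolp finmap.

Set Implicit Arguments.
Unset Strict Implicit.
Unset Printing Implicit Defensive.

Local Open Scope classical_set_scope.

Lemma sat_set0 phi : ~~ contains_NE phi -> sat set0 phi.
Proof.
elim: phi => //= [phi IH1 psi IH2|phi IH1 psi IH2|phi IH1 psi IH2];
  rewrite negb_or => /andP[n1 n2].
- by split; [exact: IH1|exact: IH2].
- by exists set0, set0; split; rewrite ?setU0//; [exact: IH1|exact: IH2].
- by left; exact: IH1.
Qed.

(** A split of [X] for a tensor is intersected with [Y]. In the tensor rules this carries the
    remaining assumptions of a subderivation from the whole team to one piece of it. *)
Lemma sat_classical_sub phi (X Y : team) :
  classical phi -> Y `<=` X -> sat X phi -> sat Y phi.
Proof.
elim: phi X Y => //= [i|i||phi IH1 psi IH2|phi IH1 psi IH2] X Y.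
- by move=> _ YX h s /YX/h.
- by move=> _ YX h s /YX/h.
- by move=> _ YX X0; rewrite -subset0 -X0.
- by case/andP=> c1 c2 YX [h1 h2]; split; [exact: IH1 h1|exact: IH2 h2].
- case/andP=> c1 c2 YX [U [V [UX VX XE h1 h2]]].
  exists (Y `&` U), (Y `&` V); split.
  + exact: subIsetl.
  + exact: subIsetl.
  + by rewrite -setIUr -XE; apply/esym/setIidPl.
  + exact: IH1 c1 (@subIsetr _ _ _) h1.
  + exact: IH2 c2 (@subIsetr _ _ _) h2.
Qed.

(** Two splits for a tensor are united componentwise. *)
Lemma sat_classical_setU phi (X Y : team) :
  classical phi -> sat X phi -> sat Y phi -> sat (X `|` Y) phi.
Proof.
elim: phi X Y => //= [i|i||phi IH1 psi IH2|phi IH1 psi IH2] X Y.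
- by move=> _ h1 h2 s [/h1|/h2].
- by move=> _ h1 h2 s [/h1|/h2].
- by move=> _ -> ->; rewrite setU0.
- by case/andP=> c1 c2 [a b] [c d]; split; [exact: IH1|exact: IH2].
- case/andP=> c1 c2 [U [V [UX VX XE h1 h2]]] [U' [V' [UY VY YE h1' h2']]].
  exists (U `|` U'), (V `|` V'); split.
  + exact: setUSS.
  + exact: setUSS.
  + by rewrite XE YE setUACA.
  + exact: IH1.
  + exact: IH2.
Qed.

Lemma sat_tensor_Bot (X : team) phi : sat X (Tensor phi Bot) <-> sat X phi.
Proof.
split=> [[Y [Z [_ _ -> h /= ->]]]|h]; first by rewrite setU0.
by exists X, set0; split; rewrite ?setU0.
Qed.

(** [iterate] ends a nonempty list in its last entry, without a final [Bot]; as a tensor with [Bot]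
    changes nothing, the recursion becomes uniform. *)
Lemma sat_big_tensor_cons (X : team) phi l :
  sat X (big_tensor (phi :: l)) <-> sat X (Tensor phi (big_tensor l)).
Proof. by case: l => [|psi l] //; rewrite sat_tensor_Bot. Qed.

(** Without repetitions in [l], the pieces of the split can be indexed by the entries; a repeated
    entry could call for two pieces whose union fails [f i]. *)
Lemma sat_big_tensor_map (I : eqType) (f : I -> form) (l : seq I) (X : team) :
  uniq l ->
  sat X (big_tensor [seq f i | i <- l]) <->
  exists2 F : I -> team, X = \bigcup_(i in [set i | i \in l]) F i &
    forall i, i \in l -> sat (F i) (f i).
Proof.
elim: l X => [|a l IH] X /=.
  move=> _; split=> [->|[F -> _]].
    by exists (fun=> set0) => //; apply/esym/bigcup0.
  by rewrite -subset0 => s [i].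
case/andP=> al ul; rewrite sat_big_tensor_cons; split.
  case=> Y [Z [_ _ -> hY /(IH _ ul)[F -> hF]]].
  (* Overriding [F] at [a] leaves the tail intact because [a] is not in [l]. *)
  exists (fun i => if i == a then Y else F i).
    apply/seteqP; split=> s.
      case=> [Ys|[i /= il Fs]].
        by exists a; rewrite /= ?mem_head ?eqxx.
      exists i; first by rewrite /= inE il orbT.
      by case: eqP il al => [-> ->|].
    case=> i /=; rewrite inE; case: eqP => [_ _ Ys|_ /= il Fs]; first by left.
    by right; exists i.
  move=> i; rewrite inE; case: eqP => [-> //|_ /=]; exact: hF.
case=> F XE hF; exists (F a), (\bigcup_(i in [set i | i \in l]) F i).
have XU : X = F a `|` \bigcup_(i in [set i | i \in l]) F i.
  rewrite XE; apply/seteqP; split=> s.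
    case=> i /=; rewrite inE => /predU1P[->|il] Fs; first by left.
    by right; exists i.
  case=> [Fs|[i /= il Fs]]; first by exists a; rewrite //= mem_head.
  by exists i; rewrite //= inE il orbT.
split=> //.
- by rewrite [X in _ `<=` X]XU; exact: subsetUl.
- by rewrite [X in _ `<=` X]XU; exact: subsetUr.
- by apply: hF; rewrite mem_head.
- by apply/(IH _ ul); exists F => // i il; apply: hF; rewrite inE il orbT.
Qed.

Lemma sat_big_or_map (I : eqType) (f : I -> form) (l : seq I) (X : team) i :
  i \in l -> sat X (f i) -> sat X (big_or [seq f j | j <- l]).
Proof.
elim: l => // a [|b l] IH; rewrite in_cons => /predU1P[<-|il] h //=.
- by left.
- by right; exact: IH.
Qed.

Definition restrict (N : {fset nat}) (v : valuation) : {ffun N -> bool} :=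
  [ffun i => v (val i)].

Lemma sat_literals (N : {fset nat}) (s : {ffun N -> bool}) (l : seq N)
    (X : team) :
  sat X (foldr And NE [seq lit (val i) (s i) | i <- l]) ->
  X <> set0 /\ forall v, X v -> forall i, i \in l -> v (val i) = s i.
Proof.
elim: l => //= a l IH [ha /IH[X0 hl]]; split=> // v Xv i.
rewrite inE => /predU1P[->|]; last exact: hl.
by move: ha; rewrite /lit; case: (s a) => /(_ v Xv).
Qed.

(** The conjunct [NE] gives the piece of each [s] a member, and the literals make all its members
    restrict to [s]. So [T] determines [X]. *)
Lemma sat_Theta (N : {fset nat}) (X : {set {ffun N -> bool}}) (T : team) :
  sat T (Theta X) ->
  forall s, s \in X <-> exists2 v, T v & restrict N v = s.
Proof.
case/(sat_big_tensor_map _ _ (enum_uniq _)) => F -> hF.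
have FE s v : s \in X -> F s v -> restrict N v = s.
  rewrite -mem_enum => /hF/sat_literals[_ h] Fv.
  by apply/ffunP => i; rewrite ffunE h // mem_enum.
move=> s; split=> [sX|[v [s' /=]]].
  have := hF s; rewrite mem_enum => /(_ sX)/sat_literals[/eqP/set0P[v Fv] _].
  by exists v; [exists s; rewrite //= mem_enum|exact: FE Fv].
by rewrite mem_enum => s'X Fv <-; rewrite (FE s').
Qed.

Lemma sat_NE_big_tensor (I : finType) (phi : I -> form) (X : team) :
  X <> set0 -> sat X (big_tensor [seq phi i | i <- enum I]) ->
  sat X (big_or [seq big_tensor [seq And NE (phi i) | i <- enum J]
    | J : {set I} <- enum [pred J : {set I} | J != finset.set0]]).
Proof.
move=> X0 /(sat_big_tensor_map _ _ (enum_uniq _))[F XE hF].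
pose J := [set i | `[< F i <> set0 >]]%SET.
have inJ i v : F i v -> i \in J.
  by move=> Fv; rewrite inE; apply/asboolP/eqP/set0P; exists v.
apply: (@sat_big_or_map _ _ _ _ J).
  rewrite mem_enum inE; apply/finset.set0Pn.
  move/eqP/set0P: X0 => [v]; rewrite XE => -[i _ Fv].
  by exists i; exact: inJ Fv.
(* The same family serves on [J]: the pieces left out are empty. *)
apply/(sat_big_tensor_map _ _ (enum_uniq _)); exists F.
  rewrite XE; apply/seteqP; split=> v [i _ Fv]; exists i => //=.
    by rewrite mem_enum; exact: inJ Fv.
  by rewrite mem_enum.
move=> i; rewrite mem_enum inE => /asboolP Fi; split=> //.
by apply: hF; rewrite mem_enum.
Qed.

(** Prepares the induction hypothesis of a subderivation; in the tensor rules [X] is only a piece of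
    the original team. *)
Lemma sat_discharge (B : set form) phi (X : team) :
  sat X phi -> (forall theta, (B `\ phi) theta -> sat X theta) ->
  forall theta, B theta -> sat X theta.
Proof.
move=> h hB theta Bt; have [->//|nt] := pselect (theta = phi).
exact: hB.
Qed.

Lemma deriv_sound A phi : deriv A phi -> entails A phi.
Proof.
elim=> {A phi}.
- by move=> phi X; apply.
- move=> i X _; exists [set s | X s /\ s i = true], [set s | X s /\ s i = false].
  split=> [s []|s []||s []|s []] //; apply/seteqP; split=> s; last by do 2!case.
  by move=> Xs; case: (boolP (s i)) => [|/negbTE] si; [left|right].
- by move=> X _; have [|] := pselect (X = set0); [left|right].
- move=> A B phi psi _ h1 _ h2 X hX.
  by split; [apply: h1|apply: h2] => theta Ht; apply: hX; [left|right].
- by move=> A phi psi _ h X /h[].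
- by move=> A phi psi _ h X /h[].
- by move=> A phi psi _ h X /h; left.
- by move=> A phi psi _ h X /h; right.
- move=> A B C phi psi chi _ hA _ hB _ hC X hX.
  case: (hA X) => [theta At|hp|hp]; first by apply: hX; left; left.
    by apply/hB/(sat_discharge hp) => theta Bt; apply: hX; left; right.
  by apply/hC/(sat_discharge hp) => theta Ct; apply: hX; right.
(* [D_tensorI]: the empty team serves as the piece for the NE-free [psi]. *)
- move=> A phi psi nNE _ h X /h hp; exists X, set0.
  by split; rewrite ?setU0 //; exact: sat_set0.
- by move=> A phi _ h X /h hp; exists X, X; split; rewrite ?setUid.
- move=> A B C phi psi alpha ca cB cC _ hA _ hB _ hC X hX.
  case: (hA X) => [theta At|Y [Z [YX ZX -> hY hZ]]].
    by apply: hX; left; left.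
  (* As [alpha] is classical, it suffices to obtain it on [Y] and on [Z], where the classical side
     assumptions still hold. *)
  apply: sat_classical_setU => //.
    apply/hB/(sat_discharge hY) => theta Bt.
    by apply: sat_classical_sub YX _; [exact: cB|apply: hX; left; right].
  apply/hC/(sat_discharge hZ) => theta Ct.
  by apply: sat_classical_sub ZX _; [exact: cC|apply: hX; right].
- move=> A B phi psi chi cB _ hA _ hB X hX.
  case: (hA X) => [theta At|Y [Z [YX ZX XE hY hZ]]]; first by apply: hX; left.
  exists Y, Z; split=> //; apply/hB/(sat_discharge hZ) => theta Bt.
  by apply: sat_classical_sub ZX _; [exact: cB|apply: hX; right].
- move=> A phi psi _ h X /h[Y [Z [YX ZX XE hY hZ]]].
  by exists Z, Y; split=> //; rewrite setUC.
- move=> A phi psi chi _ h X /h[Y [Z [YX ZX XE hY [U [V [UZ VZ ZE hU hV]]]]]].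
  exists (Y `|` U), V; split=> //.
  + by rewrite subUset; split=> //; exact: subset_trans ZX.
  + exact: subset_trans ZX.
  + by rewrite XE ZE setUA.
  + by exists Y, U; split.
- move=> A i _ h X /h[/= h1 h2]; rewrite -subset0 => s Xs.
  by move: (h1 s Xs); rewrite h2.
- by move=> A phi _ h X /h/sat_tensor_Bot.
- by move=> A phi _ h X /h[].
(* [D_tensor_exfalso]: the second piece would be both empty and nonempty. *)
- by move=> A phi _ h X /h[Y [Z [_ _ _ _ []]]].
(* [D_Theta]: both [X] and [Y] would be the set of restrictions of [T]. *)
- move=> A N X Y XY _ h T /h[/sat_Theta hX /sat_Theta hY]; exfalso; apply: XY.
  by apply/setP => s; apply/idP/idP => [/hX/hY|/hY/hX].
- move=> A phi psi chi _ h X /h[Y [Z [YX ZX XE hY [hZ|hZ]]]]; [left|right];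
  by exists Y, Z.
- by move=> A I phi _ h X /h[]; exact: sat_NE_big_tensor.
Qed.

Theorem theorem5p3 (Gamma : set form) (phi : form) :
  provable Gamma phi -> entails Gamma phi.
Proof.
by case=> A AG /deriv_sound h X hX; apply: h => psi /AG; exact: hX.
Qed.
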